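(* Let $r$ be a power of $2$. For each odd integer $n>0$ let $A_n\in t\,\mathbb{Z}/2[t^2]$, and suppose that for all odd $n>0$ \[ A_{n+8r}=t^{8r}A_n+t^{2r}A_{n+2r}. \] If for every odd $n<8r^2$, $A_n$ is a sum of monomials preceding $t^n$, then for every odd $n>0$, $A_n$ is a sum of monomials preceding $t^n$.
   Context: $\mathbb{N}=\{0,1,2,\dots\}$. Let $g:\mathbb{N}\to\mathbb{N}$ be defined by $g(0)=0$, $g(2n)=4g(n)$, $g(2n+1)=g(2n)+1$. For $a,b\in\mathbb{N}$, $[a,b]$ denotes the monomial $t^{1+2g(a)+4g(b)}\in\mathbb{Z}/2[t]$; $(a,b)\mapsto[a,b]$ is a bijection from $\mathbb{N}\times\mathbb{N}$ onto the monomials $t^k$, $k$ odd and positive. Say $[c,d]$ precedes (is earlier than) $[a,b]$ if $c+d<a+b$, or $c+d=a+b$ and $d<b$. ''A sum of monomials'' with some property means a finite sum (possibly empty, i.e. $0$) of distinct monomials with that property. *)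

(* Defs.v *)
From mathcomp Require Import all_boot all_order all_algebra.

Set Implicit Arguments.
Unset Strict Implicit.
Unset Printing Implicit Defensive.

Import GRing.Theory.

(* Fuel-bounded recursion on the binary digits of n; any fuel >= n gives the
   same value. The defining equations of g are g0, g_even and g_odd below. *)
Fixpoint g_rec (fuel n : nat) : nat :=
  if fuel is fuel'.+1 then
    if n == 0 then 0 else 4 * g_rec fuel' n./2 + odd n
  else 0.

Definition g (n : nat) : nat := g_rec n n.

Lemma g_rec_fuel (f n : nat) : n <= f -> g_rec f n = g n.
Proof.
rewrite /g; suff H : forall f1 f2 m, m <= f1 -> m <= f2 ->
    g_rec f1 m = g_rec f2 m by move=> le_nf; apply: H.
elim=> [|f1 IH] [|f2] [|m] //= le1 le2.
have hm : uphalf m <= m by rewrite leq_uphalf_double -addnn leq_addr.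
by rewrite (IH f2) //; apply: leq_trans hm _.
Qed.

Lemma g0 : g 0 = 0.
Proof. by []. Qed.

Lemma g_half (n : nat) : g n = 4 * g n./2 + odd n.
Proof.
case: n => [|n] //.
rewrite {1}/g /= g_rec_fuel //.
by rewrite leq_uphalf_double -addnn leq_addr.
Qed.

Lemma g_even (n : nat) : g (2 * n) = 4 * g n.
Proof. by rewrite g_half mul2n doubleK odd_double addn0. Qed.

Lemma g_odd (n : nat) : g (2 * n + 1) = g (2 * n) + 1.
Proof.
by rewrite g_even g_half addn1 mul2n /= odd_double uphalf_double.
Qed.

Local Open Scope ring_scope.

Definition mon (a b : nat) : {poly 'F_2} := 'X^(1 + 2 * g a + 4 * g b).

Definition precedes (p q : {poly 'F_2}) : Prop :=
  exists c d a b : nat,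
    [/\ p = mon c d, q = mon a b &
        (c + d < a + b)%N \/ (c + d = a + b)%N /\ (d < b)%N].

Definition sum_of_monomials (P : {poly 'F_2} -> Prop) (f : {poly 'F_2}) : Prop :=
  exists s : seq {poly 'F_2},
    [/\ uniq s, forall p, p \in s -> P p & f = \sum_(p <- s) p].

(* Membership in t Z/2[t^2]. *)
Definition in_tF2t2 (f : {poly 'F_2}) : Prop :=
  exists q : {poly 'F_2}, f = 'X * (q \Po 'X^2).

(* Main.v *)
Require Import Defs.
From mathcomp Require Import all_boot all_order all_algebra.
From mathcomp Require Import zify.

Import GRing.Theory.
Local Open Scope ring_scope.

(** Squaring the operator identity E^4 = T^4 + T E (E the shift by 2r, T the
    multiplication by t^(2r)) in characteristic 2 shows that the recursion for r
    implies the one for every s = 2^e >= r.  For n >= 8r pick s with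
    8s <= n < 16s, so that A_n = t^(8s) A_(n-8s) + t^(2s) A_(n-6s).  In terms of
    (a, b), adding 2^e to the bit-interleaving of a and b increases a + b by at
    most 2^(e/2), and in case of equality increases b by at most 2^(e/2) if e is
    odd and not at all if e is even; when 2^e exceeds the number being added to,
    these bounds are attained.  Hence both terms only involve monomials
    preceding t^n. *)

(** Since [g] reads binary digits in base 4, the bits of [a] fill the even places and those of [b]
    the odd ones; [a,b] has exponent [2 * interleave a b + 1]. *)
Definition interleave (a b : nat) : nat := (g a + 2 * g b)%N.

Lemma interleave_half a b :
  interleave a b = (4 * interleave a./2 b./2 + odd a + 2 * odd b)%N.
Proof. by rewrite /interleave (g_half a) (g_half b); lia. Qed.

Lemma interleave_bits a b (x y : bool) :
  interleave (2 * a + x) (2 * b + y) = (4 * interleave a b + x + 2 * y)%N.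
Proof.
rewrite interleave_half.
have -> : ((2 * a + x)./2 = a)%N by lia.
have -> : ((2 * b + y)./2 = b)%N by lia.
have -> : odd (2 * a + x) = x by lia.
by have -> : odd (2 * b + y) = y by lia.
Qed.

Lemma bitsP a : exists a0 (x : bool), a = (2 * a0 + x)%N.
Proof. by exists a./2, (odd a); lia. Qed.

Lemma interleave_surj m : exists a b, m = interleave a b.
Proof.
elim/ltn_ind: m => -[|m] IH; first by exists 0%N, 0%N.
have [a [b def_q]] := IH (m.+1 %/ 4)%N ltac:(lia).
exists (2 * a + odd m.+1)%N, (2 * b + odd (m.+1)./2)%N.
by rewrite interleave_bits -def_q; lia.
Qed.

Lemma interleave_inj a b c d :
  interleave a b = interleave c d -> a = c /\ b = d.
Proof.
have [k] := ubnP (a + b + c + d)%N.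
elim: k a b c d => // k IH a b c d.
have [a0 [x ->]] := bitsP a; have [b0 [y ->]] := bitsP b.
have [c0 [z ->]] := bitsP c; have [d0 [w ->]] := bitsP d.
rewrite !interleave_bits => lt_k E.
have [z0|n0] := eqVneq (a0 + b0 + c0 + d0)%N 0%N; first by lia.
by have [] := IH a0 b0 c0 d0 ltac:(lia) ltac:(lia); lia.
Qed.

(** If the lowest bit pair is not (1, 1), only that pair changes. Otherwise clearing it lowers the
    sum by 2, and the carry, by induction, gives back at most 2. *)
Lemma interleaveS a b : exists a' b',
  interleave a' b' = (interleave a b).+1 /\
  ((a' + b' < a + b + 1)%N \/ (a' + b' = a + b + 1)%N /\ (b' <= b)%N).
Proof.
elim/ltn_ind: a b => a IH b.
have [a0 [x Ea]] := bitsP a; have [b0 [y Eb]] := bitsP b; subst a b.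
case: x y IH => [] [] IH.
- have [a' [b' [E lt_s]]] := IH a0 ltac:(lia) b0.
  exists (2 * a' + false)%N, (2 * b' + false)%N; rewrite !interleave_bits E.
  by split; lia.
- by exists (2 * a0 + false)%N, (2 * b0 + true)%N; rewrite !interleave_bits; lia.
- by exists (2 * a0 + true)%N, (2 * b0 + true)%N; rewrite !interleave_bits; lia.
- by exists (2 * a0 + true)%N, (2 * b0 + false)%N; rewrite !interleave_bits; lia.
Qed.

(** Adding [2 ^ e.+2] keeps the lowest bit pair and adds [2 ^ e] to the number above it, so the
    induction goes by steps of 2. *)
Lemma interleave_add_exp2 e a b : exists a' b',
  interleave a' b' = (interleave a b + 2 ^ e)%N /\
  ((a' + b' < a + b + 2 ^ e./2)%N \/
   (a' + b' = a + b + 2 ^ e./2)%N /\ (b' <= b + odd e * 2 ^ e./2)%N).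
Proof.
elim/ltn_ind: e a b => -[|[|e]] IH a b.
- have [a' [b' [E lt_s]]] := interleaveS a b.
  by exists a', b'; rewrite E /= expn0; lia.
(* For exponent 1, the low bit of [b] gets set, or it is cleared with a carry into the higher
   pairs. *)
- have [a0 [x ->]] := bitsP a; have [b0 [[] ->]] := bitsP b; last first.
    exists (2 * a0 + x)%N, (2 * b0 + true)%N; rewrite !interleave_bits /= expn0.
    by lia.
  have [a' [b' [E lt_s]]] := interleaveS a0 b0.
  exists (2 * a' + x)%N, (2 * b' + false)%N.
  by rewrite !interleave_bits E /= expn0; lia.
have [a0 [x ->]] := bitsP a; have [b0 [y ->]] := bitsP b.
have [a' [b' [E lt_s]]] := IH e ltac:(lia) a0 b0.
exists (2 * a' + x)%N, (2 * b' + y)%N.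
rewrite !interleave_bits E /= !negbK !expnS.
by move: lt_s; case: (odd e) => /=; lia.
Qed.

(** Bit [e] is still clear, so nothing carries: it becomes bit [e./2] of [a] or of [b], according to
    parity. *)
Lemma interleave_top e a b : (interleave a b < 2 ^ e)%N ->
  interleave (a + ~~ odd e * 2 ^ e./2) (b + odd e * 2 ^ e./2)
    = (interleave a b + 2 ^ e)%N.
Proof.
elim/ltn_ind: e a b => -[|[|e]] IH a b.
- rewrite expn0 ltnS leqn0 => /eqP E0.
  by have [-> ->] := @interleave_inj a b 0 0 E0.
- have [a0 [x ->]] := bitsP a; have [b0 [y ->]] := bitsP b.
  rewrite interleave_bits => lt2.
  have [-> ->] := @interleave_inj a0 b0 0 0 ltac:(by rewrite {2}/interleave g0; lia).
  have -> : y = false by lia.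
  by case: x {lt2}.
have [a0 [x ->]] := bitsP a; have [b0 [y ->]] := bitsP b.
rewrite interleave_bits !expnS /= !negbK => lt_e.
have {}IH := IH e ltac:(lia) a0 b0 ltac:(lia).
have -> : (2 * a0 + x + ~~ odd e * (2 * 2 ^ e./2)
           = 2 * (a0 + ~~ odd e * 2 ^ e./2) + x)%N by lia.
have -> : (2 * b0 + y + odd e * (2 * 2 ^ e./2)
           = 2 * (b0 + odd e * 2 ^ e./2) + y)%N by lia.
by rewrite interleave_bits IH; lia.
Qed.

(* The order on odd exponents transported to l |-> t^(2l+1). *)
Definition earlier (l m : nat) : Prop := exists c d a b : nat,
  [/\ l = interleave c d, m = interleave a b &
      (c + d < a + b)%N \/ (c + d = a + b)%N /\ (d < b)%N].

(** The growth of the sum, then of the second entry, is bounded on the left and attains that bound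
    on the right. *)
Lemma earlier_add_top e l p : (p < 2 ^ e)%N ->
  earlier l p -> earlier (l + 2 ^ e) (p + 2 ^ e).
Proof.
move=> lt_p [c [d [a [b [-> Ep lt_cd]]]]]; subst p.
have [c' [d' [E' lt']]] := interleave_add_exp2 e c d.
exists c', d', (a + ~~ odd e * 2 ^ e./2)%N, (b + odd e * 2 ^ e./2)%N.
rewrite E' interleave_top //; split=> //.
by move: lt'; case: (odd e) => /=; lia.
Qed.

(** Two additions of [2 ^ e], one to [p] and one to [l], each raise the sum by at most [2 ^ e./2];
    adding [2 ^ e.+2] to [p] raises it by exactly twice that. Second entries compare likewise, as
    [e] and [e.+2] have the same parity. *)
Lemma earlier_add_quarter e l p : (p < 2 ^ e.+2)%N ->
  earlier l (p + 2 ^ e) -> earlier (l + 2 ^ e) (p + 2 ^ e.+2).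
Proof.
move=> lt_p [c [d [a [b [-> Ep lt_cd]]]]].
have [a0 [b0 Ep0]] := interleave_surj p; subst p.
have [a' [b' [E' lt']]] := interleave_add_exp2 e a0 b0.
(* The pair of [p + 2 ^ e] is unique, so the growth bound applies to the given one. *)
have [Ea Eb] := interleave_inj _ _ _ _ (etrans E' Ep); subst a' b'.
have [c' [d' [Ec' ltc']]] := interleave_add_exp2 e c d.
exists c', d', (a0 + ~~ odd e.+2 * 2 ^ e.+2./2)%N, (b0 + odd e.+2 * 2 ^ e.+2./2)%N.
rewrite Ec' interleave_top //; split=> //=.
by move: lt' ltc'; rewrite !negbK expnS; case: (odd e) => /=; lia.
Qed.

Lemma precedes_earlier k n : odd n ->
  precedes 'X^k 'X^n -> exists2 l, k = (2 * l + 1)%N & earlier l n./2.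
Proof.
have Xinj i j : 'X^i = 'X^j :> {poly 'F_2} -> i = j.
  by move/(congr1 (fun p : {poly 'F_2} => size p)); rewrite !size_polyXn => -[].
move=> odd_n [c [d [a [b [/Xinj Ek /Xinj En lt_cd]]]]].
exists (interleave c d); first by rewrite Ek /interleave; lia.
by exists c, d, a, b; split=> //; rewrite En /interleave; lia.
Qed.

Lemma earlier_precedes l m :
  earlier l m -> precedes 'X^(2 * l + 1) 'X^(2 * m + 1).
Proof.
move=> [c [d [a [b [-> -> lt_cd]]]]]; exists c, d, a, b.
by split=> //; congr 'X^_; rewrite /interleave; lia.
Qed.

(** Nonzero coefficients in ['F_2] equal 1, so a polynomial is the sum of the monomials in its
    support. *)
Lemma sum_of_monomialsP (n : nat) (f : {poly 'F_2}) :
  sum_of_monomials (fun p => precedes p 'X^n) f <->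
  (forall k, f`_k != 0 -> precedes 'X^k 'X^n).
Proof.
split=> [[s [_ Ps ->]] k|Pf].
  rewrite coef_sum => nz.
  have /hasP[p ps pk] : has (fun p : {poly 'F_2} => p`_k != 0) s.
    apply: contraNT nz => /hasPn s0; rewrite big_seq big1 // => p /s0.
    by rewrite negbK => /eqP.
  have prec_p := Ps p ps.
  have [c [d [a [b [Ep _ _]]]]] := prec_p.
  move: pk prec_p; rewrite Ep /mon coefXn.
  by case: (k =P _) => [-> //|_]; rewrite eqxx.
exists [seq 'X^k | k <- index_iota 0 (size f) & f`_k != 0]; split.
- rewrite map_inj_uniq ?filter_uniq ?iota_uniq // => i j.
  by move/(congr1 (fun p : {poly 'F_2} => size p)); rewrite !size_polyXn => -[].
- by move=> p /mapP[k]; rewrite mem_filter => /andP[nz _] ->; apply: Pf.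
rewrite big_map big_filter -{1}[f]coefK poly_def [RHS]big_mkcond big_mkord.
apply: eq_bigr => i _.
have [->|nz] := eqVneq f`_i 0; first by rewrite scale0r.
suff -> : f`_i = 1 by rewrite scale1r.
by move: f`_i nz => [[|[|]] lt2] // _; apply: val_inj.
Qed.

Lemma rec_exp2 (A : nat -> {poly 'F_2}) (r : nat) :
  (forall n, odd n ->
     A (n + 8 * r)%N = 'X^(8 * r) * A n + 'X^(2 * r) * A (n + 2 * r)%N) ->
  forall j n, odd n ->
    A (n + 8 * (r * 2 ^ j))%N = 'X^(8 * (r * 2 ^ j)) * A n
      + 'X^(2 * (r * 2 ^ j)) * A (n + 2 * (r * 2 ^ j))%N.
Proof.
move=> rec_r; elim=> [|j IH] n odd_n; first by rewrite muln1 rec_r.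
rewrite expnS; set s := (r * 2 ^ j)%N in IH *.
have -> : (r * (2 * 2 ^ j) = 2 * s)%N by rewrite /s; lia.
have -> : (n + 8 * (2 * s) = n + 8 * s + 8 * s)%N by lia.
rewrite IH; last by lia.
have -> : (n + 8 * s + 2 * s = n + 2 * s + 8 * s)%N by lia.
rewrite !IH //; try lia.
have -> : (n + 2 * s + 2 * s = n + 2 * (2 * s))%N by lia.
(* The two cross terms of the squared operator cancel in characteristic 2. *)
have X2 : 'X^(8 * s) * ('X^(2 * s) * A (n + 2 * s)%N)
   + 'X^(2 * s) * ('X^(8 * s) * A (n + 2 * s)%N) = 0.
  by rewrite !mulrA -exprD addnC exprD -mulrDl addrr_pchar2 ?mul0r //
    pchar_poly pchar_Fp.
have -> : (8 * (2 * s) = 8 * s + 8 * s)%N by lia.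
have -> : (2 * (2 * s) = 2 * s + 2 * s)%N by lia.
by rewrite !mulrDr -addrA [X in _ + X]addrA X2 add0r !exprD !mulrA.
Qed.

(* The values of A at even indices are unconstrained and unused. *)
Theorem theorem3p1 (r : nat) (hr : exists k : nat, r = (2 ^ k)%N)
    (A : nat -> {poly 'F_2})
    (hA : forall n : nat, odd n -> in_tF2t2 (A n))
    (hrec : forall n : nat, odd n ->
       A (n + 8 * r)%N = 'X^(8 * r) * A n + 'X^(2 * r) * A (n + 2 * r)%N)
    (hinit : forall n : nat, odd n -> (n < 8 * r ^ 2)%N ->
       sum_of_monomials (fun p => precedes p 'X^n) (A n)) :
  forall n : nat, odd n -> sum_of_monomials (fun p => precedes p 'X^n) (A n).
Proof.
elim/ltn_ind=> n IH odd_n.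
have [lt_n|le_n] := ltnP n (8 * r ^ 2); first exact: hinit.
have [k Er] := hr.
(* Chosen so that [s = 2 ^ e] satisfies 8s <= n < 16s; [8 * r <= n] will give [k <= e]. *)
pose e := (trunc_log 2 n - 3)%N.
have r_gt0 : (0 < r)%N by rewrite Er expn_gt0.
have n_ge : (2 ^ (k + 3) <= n)%N.
  by apply: leq_trans le_n; rewrite expnD -Er mulnC leq_mul2l -mulnn leq_pmulr.
have n_gt0 : (0 < n)%N by lia.
have le_log : (k + 3 <= trunc_log 2 n)%N by apply: trunc_log_max.
have log_e : trunc_log 2 n = (e + 3)%N by rewrite /e; lia.
have /andP[le_e lt_e] := trunc_log_bounds (ltnSn 1) n_gt0.
move: le_e lt_e; rewrite log_e expnS expnD => le_e lt_e.
set s := (2 ^ e)%N in le_e lt_e.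
have s_gt0 : (0 < s)%N by rewrite expn_gt0.
have Es : (r * 2 ^ (e - k) = s)%N by rewrite Er -expnD subnKC //; lia.
(* Here n - 8s = 2p + 1 with p < 4s, so bit [e.+2] of [p] is clear. *)
pose p := (n./2 - 4 * s)%N.
have En : n = (2 * p + 1 + 8 * s)%N by rewrite /p; lia.
have lt_p : (p < 2 ^ e.+2)%N by rewrite !expnS -/s; lia.
have Eh : n./2 = (p + 2 ^ e.+2)%N by rewrite !expnS -/s; lia.
have := @rec_exp2 A r hrec (e - k) (2 * p + 1)%N ltac:(lia).
rewrite Es -En => ->.
have /sum_of_monomialsP IH1 := IH (2 * p + 1)%N ltac:(lia) ltac:(lia).
have /sum_of_monomialsP IH2 := IH (2 * p + 1 + 2 * s)%N ltac:(lia) ltac:(lia).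
apply/sum_of_monomialsP => i; rewrite coefD !coefXnM.
have -> : n = (2 * (p + 2 ^ e.+2) + 1)%N by lia.
(* A nonzero coefficient of the sum comes from one of the two terms. *)
have [nz1 _|z1] :=
  boolP ((if (i < 8 * s)%N then 0 else (A (2 * p + 1))`_(i - 8 * s)) != 0).
  move: nz1; case: ltnP => [_|le_i]; first by rewrite eqxx.
  move=> /IH1/precedes_earlier[|l El]; first by lia.
  have -> : (2 * p + 1)./2 = p by lia.
  move=> /(earlier_add_top _ _ _ lt_p)/earlier_precedes.
  by have -> : (2 * (l + 2 ^ e.+2) + 1 = i)%N by rewrite !expnS -/s; lia.
move: z1; rewrite negbK => /eqP ->.
rewrite add0r; case: ltnP => [_|le_i]; first by rewrite eqxx.
move=> /IH2/precedes_earlier[|l El]; first by lia.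
have -> : (2 * p + 1 + 2 * s)./2 = (p + 2 ^ e)%N by rewrite -/s; lia.
move=> /(earlier_add_quarter _ _ _ lt_p)/earlier_precedes.
by have -> : (2 * (l + 2 ^ e) + 1 = i)%N by rewrite -/s; lia.
Qed.
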